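(* Let $X$ be a ($T_1$) topological space. Then $\mathrm{cs}^*_\chi(X)=\mathrm{cs}_\chi(X)$ provided one of the following conditions is satisfied: (1) $\mathrm{cs}^*_\chi(X)<\mathfrak p$; (2) $\kappa^{\aleph_0}\le\mathrm{cs}^*_\chi(X)$ for any cardinal $\kappa<\mathrm{cs}^*_\chi(X)$; (3) $\mathfrak p=\mathfrak c$, and $\lambda^\omega\le\kappa$ for any cardinals $\lambda<\kappa$ with $\kappa\ge\mathfrak c$; (4) $\mathfrak p=\mathfrak c$ and $X$ is countable; (5) the Generalized Continuum Hypothesis holds.
   Context: All topological spaces are assumed to be $T_1$. A family $\mathcal N$ of subsets of $X$ is a $\mathrm{cs}$-network (resp. $\mathrm{cs}^*$-network) at $x\in X$ if for every neighborhood $U$ of $x$ and every sequence $(x_n)\subset X$ convergent to $x$ there is $N\in\mathcal N$ with $N\subset U$ such that $x_n\in N$ for all but finitely many (resp. for infinitely many) $n$. $\mathrm{cs}_\chi(X)$ (resp. $\mathrm{cs}^*_\chi(X)$) is the supremum over $x\in X$ of the smallest size of a $\mathrm{cs}$-network (resp. $\mathrm{cs}^*$-network) at $x$; both are $1$ for $X=\emptyset$. $\mathfrak c=2^{\aleph_0}$, and $\mathfrak p$ is the smallest size of a family $\mathcal F$ of infinite subsets of $\omega$ which is closed under finite intersections and has no infinite pseudo-intersection, i.e. there is no infinite $I\subset\omega$ such that $I\setminus F$ is finite for every $F\in\mathcal F$. *)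

(* Defs.v *)
From HB Require Import structures.
From mathcomp Require Import all_boot all_order.
From mathcomp Require Import boolp classical_sets functions cardinality.
From mathcomp Require Import filter topology.

Set Implicit Arguments.
Unset Strict Implicit.
Unset Printing Implicit Defensive.

Local Open Scope classical_set_scope.
Local Open Scope card_scope.

(* A cardinal is represented by a set (or by the full set of
   a type) having that cardinality; cardinals are compared with [#<=] and [#=],
   so that equality of cardinals is [#=]. *)

Definition card_lt (T U : Type) (A : set T) (B : set U) : Prop :=
  A #<= B /\ ~ (B #<= A).

(* A member of [P] of the smallest cardinality. By [least_cardP] it exists
   whenever [P] is nonempty, as is the case in all the uses below. *)
Definition least_card (T : Type) (P : set (set T)) : set T :=
  xget set0 [set A | P A /\ forall B, P B -> A #<= B].

Lemma least_cardP (T : Type) (P : set (set T)) : P !=set0 ->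
  P (least_card P) /\ forall B, P B -> least_card P #<= B.
Proof.
move=> [B1 PB1].
suff [A HA] : exists A, P A /\ forall B, P B -> A #<= B.
  by have := @xgetI _ set0 [set A | P A /\ forall B, P B -> A #<= B] A HA.
pose good (F : set (set T -> T)) :=
  (forall f B, F f -> P B -> B (f B)) /\
  (forall f g B, F f -> F g -> P B -> f B = g B -> f = g).
have [|F [[Fin Finj] Fmax]] := @Zorn_bigcup (set T -> T) good.
  move=> G Ggood Gtot; split.
    by move=> f B [X GX Xf] PB; have [/(_ f B Xf PB)] := Ggood X GX.
  move=> f g B [X GX Xf] [Y GY Yg] PB.
  have [XY|YX] := Gtot X Y GX GY.
    by have [_ /(_ f g B (XY _ Xf) Yg PB)] := Ggood Y GY.
  by have [_ /(_ f g B Xf (YX _ Yg) PB)] := Ggood X GX.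
have [[A PA AF]|nA] :=
    pselect (exists2 A, P A & forall t, A t -> exists2 f, F f & f A = t).
  exists A; split => // B PB.
  have AevF : A = (fun f => f A) @` F.
    apply/seteqP; split => t; first by move=> /AF[f Ff <-]; exists f.
    by move=> [f Ff <-]; exact: (Fin f A Ff PA).
  rewrite AevF; apply: card_le_trans (card_image_le _ _) _.
  have FB : (fun f => f B) @` F #= F.
    by apply: inj_card_eq => f g /set_mem Ff /set_mem Fg; exact: (Finj f g B Ff Fg PB).
  rewrite -(card_le_eql FB); apply: subset_card_le => t [f Ff <-].
  exact: (Fin f B Ff PB).
have new B : P B -> exists t, B t /\ forall f, F f -> f B <> t.
  move=> PB; apply: contrapT => nt; apply: nA; exists B => // t Bt.
  apply: contrapT => nf; apply: nt; exists t; split => // f Ff fBt.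
  by apply: nf; exists f.
have [t0 _] := new B1 PB1.
have /choice[h hP] : forall B : set T, exists t,
    P B -> B t /\ forall f, F f -> f B <> t.
  move=> B; have [/new[t tP]|nPB] := pselect (P B); first by exists t.
  by exists t0.
exfalso; apply: (Fmax (F `|` [set h])).
  split=> [f Ff|/(_ h (or_intror erefl)) Fh]; first by left.
  by have [_ /(_ h Fh)] := hP B1 PB1.
split=> [f B [Ff|->] PB|f g B [Ff|->] [Fg|->] PB //].
- exact: (Fin f B Ff PB).
- by case: (hP B PB).
- exact: (Finj f g B Ff Fg PB).
- by move=> E; have [_ /(_ f Ff)] := hP B PB.
- by move=> E; have [_ /(_ g Fg (esym E))] := hP B PB.
Qed.

Section Networks.
Variable X : topologicalType.

Definition cs_network (x : X) (N : set (set X)) : Prop :=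
  forall (U : set X) (u : nat -> X), nbhs x U -> u @ \oo --> x ->
  exists A, [/\ N A, A `<=` U & finite_set [set n | ~ A (u n)]].

Definition cs_star_network (x : X) (N : set (set X)) : Prop :=
  forall (U : set X) (u : nat -> X), nbhs x U -> u @ \oo --> x ->
  exists A, [/\ N A, A `<=` U & infinite_set [set n | A (u n)]].

(* The supremum over [x] of the smallest size of a family satisfying
   [network x], and 1 for empty [X]. Being at most the cardinality of [set X],
   this supremum is the least upper bound among subsets of [set X]. *)
Definition network_character (network : X -> set (set (set X))) :
    set (set X) :=
  if pselect ([set: X] !=set0) then
    least_card [set K | forall x, least_card (network x) #<= K]
  else [set set0].

Definition cs_character : set (set X) := network_character cs_network.

Definition cs_star_character : set (set X) := network_character cs_star_network.

End Networks.

Arguments cs_character : clear implicits.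
Arguments cs_star_character : clear implicits.

Definition pseudo_intersection (F : set (set nat)) (I : set nat) : Prop :=
  forall A, F A -> finite_set (I `\` A).

Definition pseudo_intersection_number : set (set nat) :=
  least_card [set F : set (set nat) |
    [/\ forall A, F A -> infinite_set A, setI_closed F &
        ~ exists2 I, infinite_set I & pseudo_intersection F I]].

Definition continuum : set (nat -> bool) := [set: nat -> bool].

Definition GCH : Prop := forall K : Type, infinite_set [set: K] ->
  ~ exists L : Type, card_lt [set: K] [set: L] /\
                     card_lt [set: L] [set: set K].

(* Main.v *)
(* At every point with a finite cs*-network, T1 gives the cs-network [{{x}}], so
   let [N] be an infinite cs*-network at [x].
   If [N] is smaller than p, its finite unions form a cs-network: otherwise the
   index sets where a convergent sequence misses the finite unions inside a
   neighborhood have an infinite pseudo-intersection, giving a subsequence that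
   contradicts the cs*-property.
   If countable subsets of every family smaller than [L = cs*_chi(X)] number at
   most [L], the countable unions taken inside proper initial segments of a
   well-ordered [N] form a cs-network of size at most [L].
   Conditions (1) and (2) are these two cases; under p = c, (3) and (4) reduce to
   (1) unless c is at most [L], where (2) holds in case (3) and all subsets of the
   countable space [X] form a small enough cs-network in case (4). Under GCH even
   the power set of a family smaller than [L] has size at most [L], which includes
   [L = aleph_0], where (2) fails. *)

Require Import Defs.
From mathcomp Require Import all_boot all_order.
From mathcomp Require Import boolp classical_sets functions cardinality.
From mathcomp Require Import wochoice filter topology.

Local Open Scope classical_set_scope.
Local Open Scope card_scope.

(** * Comparability and arithmetic of cardinals *)

Lemma inj_fun_card_le {T U : Type} {A : set T} {B : set U} (f : T -> U) :
  set_fun A B f -> set_inj A f -> A #<= B.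
Proof.
move=> fAB finj; have [g] : $|{injfun A >-> B}| by apply/injfunPex; exists f.
exact: inj_card_le.
Qed.

Lemma card_le_inj_fun {T U : Type} {A : set T} {B : set U} :
  B !=set0 -> A #<= B -> exists2 f : T -> U, set_fun A B f & set_inj A f.
Proof.
by elim/Ppointed: U => U in B * => -[b _] AB; [case: (no b)|apply/injfunPex/pcard_leP].
Qed.

(** Copies of [A] and [B] in the sum type form a two-member family, whose least member, given by
    [least_cardP], embeds in the other. *)
Lemma card_le_total {T U : Type} (A : set T) (B : set U) : A #<= B \/ B #<= A.
Proof.
have [|] := @least_cardP _ [set inl @` A; inr @` B] _; first by exists (inl @` A); left.
have iA : (@inl T U) @` A #= A by apply: inj_card_eq => x y _ _ [].
have iB : (@inr T U) @` B #= B by apply: inj_card_eq => x y _ _ [].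
move=> [] -> le; [left|right].
  by rewrite -(card_le_eql iA) -(card_le_eqr iB); apply: le; right.
by rewrite -(card_le_eqr iA) -(card_le_eql iB); apply: le; left.
Qed.

Lemma not_card_le {T U : Type} {A : set T} {B : set U} : ~ (A #<= B) -> B #<= A.
Proof. by case: (card_le_total A B). Qed.

Lemma card_ltP {T U : Type} (A : set T) (B : set U) : card_lt A B <-> ~ (B #<= A).
Proof. by split=> [[]//|nBA]; split=> //; exact: not_card_le. Qed.

Lemma card_le_lt_trans {T U V : Type} {A : set T} {B : set U} {C : set V} :
  A #<= B -> card_lt B C -> card_lt A C.
Proof.
move=> AB /card_ltP BC; apply/card_ltP => CA; apply: BC.
exact: card_le_trans CA AB.
Qed.

Lemma card_lt_le_trans {T U V : Type} {A : set T} {B : set U} {C : set V} :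
  card_lt A B -> B #<= C -> card_lt A C.
Proof.
move=> /card_ltP AB BC; apply/card_ltP => CA; apply: AB.
exact: card_le_trans BC CA.
Qed.

Lemma card_le_setX {T T' U U' : Type} {A : set T} {A' : set T'}
    {B : set U} {B' : set U'} :
  A #<= A' -> B #<= B' -> A `*` B #<= A' `*` B'.
Proof.
move=> AA' BB'.
have [A'0|/set0P A'0] := eqVneq A' set0.
  by move: AA'; rewrite A'0 => /card_le0P ->; rewrite set0X.
have [B'0|/set0P B'0] := eqVneq B' set0.
  by move: BB'; rewrite B'0 => /card_le0P ->; rewrite setX0.
have [f fA finj] := card_le_inj_fun A'0 AA'.
have [g gB ginj] := card_le_inj_fun B'0 BB'.
apply: (@inj_fun_card_le _ _ _ _ (fun p => (f p.1, g p.2))).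
  by move=> [x y] [/= Ax By]; split; [exact: fA|exact: gB].
move=> [x y] [x' y'] /set_mem[/= Ax By] /set_mem[/= Ax' By'] [fx gy].
by congr pair; [apply: finj|apply: ginj] => //; exact/mem_set.
Qed.

(** A point of the union is coded by a chosen index containing it and by its code within that piece.
    The square bound is a hypothesis because this lemma also serves to prove
    [card_setX_infinite]. *)
Lemma card_bigcup_le_of_square {T U I : Type} {C : set T} {J : set I}
    {F : I -> set U} :
  C `*` C #<= C -> J #<= C -> (forall i, J i -> F i #<= C) ->
  \bigcup_(i in J) F i #<= C.
Proof.
move=> CC JC FC; apply: card_le_trans CC.
have [C0|/set0P C0] := eqVneq C set0.
  by move: JC; rewrite C0 => /card_le0P ->; rewrite bigcup_set0.
have [e eC einj] := card_le_inj_fun C0 JC.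
have /choice[h hP] : forall i, exists f : U -> T,
    J i -> set_fun (F i) C f /\ set_inj (F i) f.
  move=> i; have [Ji|nJi] := pselect (J i).
    by have [f] := card_le_inj_fun C0 (FC _ Ji); exists f.
  by have [c _] := C0; exists (fun=> c).
have [->|/set0P[_ [i0 _ _]]] := eqVneq (\bigcup_(i in J) F i) set0; first by [].
have /choice[k kP] : forall x, exists i,
    (\bigcup_(i in J) F i) x -> J i /\ F i x.
  move=> x; have [[i Ji Fix]|n] := pselect ((\bigcup_(i in J) F i) x).
    by exists i.
  by exists i0.
apply: (@inj_fun_card_le _ _ _ _ (fun x => (e (k x), h (k x) x))).
  move=> x /kP[Jk Fk]; split; first exact: eC.
  exact: (hP _ Jk).1.
move=> x y /set_mem/kP[Jk Fk] /set_mem/kP[Jk' Fk'] [exy].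
have kxy : k x = k y by apply: einj => //; exact/mem_set.
rewrite kxy.
by have [_] := hP _ Jk'; apply=> //; apply/mem_set => //; rewrite -kxy.
Qed.

Lemma card_setU_le_of_square {T U : Type} {C : set T} {A B : set U} :
  infinite_set C -> C `*` C #<= C -> A #<= C -> B #<= C -> A `|` B #<= C.
Proof.
move=> /infiniteP Cinf CC AC BC.
have -> : A `|` B = \bigcup_(b in [set: bool]) (if b then A else B).
  apply/seteqP; split => [x [Ax|Bx]|x [[] _]]; [| |by left|by right].
    by exists true.
  by exists false.
apply: card_bigcup_le_of_square => //; last by case.
exact: card_le_trans (countableP _) Cinf.
Qed.

(* By Zorn's lemma there is a maximal injection [B * B -> B] with [B `<=` A]
   infinite; if [A] were larger than [B], it would contain a copy of [B]
   disjoint from [B], in which there is room to extend the injection. *)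
Lemma card_setX_infinite {T : Type} (A : set T) : infinite_set A -> A `*` A #<= A.
Proof.
move=> Ainf.
pose ok (p : set T * (T * T -> T)) := [/\ p.1 `<=` A, infinite_set p.1,
  set_fun (p.1 `*` p.1) p.1 p.2 & set_inj (p.1 `*` p.1) p.2].
have sq p : ok p -> p.1 `*` p.1 #<= p.1 by move=> [_ _]; exact: inj_fun_card_le.
have of_sq (B : set T) : B `<=` A -> infinite_set B -> B `*` B #<= B ->
    exists f, ok (B, f).
  by move=> BA Binf /(card_le_inj_fun (infinite_setN0 Binf))[f fB finj]; exists f.
(* The start is a countably infinite subset of [A], whose square is countable. *)
have [p0 p0ok] : exists p, ok p.
  have [g gA ginj] := card_le_inj_fun (infinite_setN0 Ainf) ((infiniteP A).1 Ainf).
  have gnat : range g #= [set: nat] by exact: inj_card_eq.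
  have [| | |f fok] := of_sq (range g); last by exists (range g, f).
  - by move=> _ [n _ <-]; exact: gA.
  - by apply/infiniteP; rewrite (card_le_eqr gnat).
  - rewrite (card_le_eqr gnat).
    apply: card_le_trans (_ : [set: nat] `*` [set: nat] #<= _).
      by apply: card_le_setX; rewrite (card_le_eql gnat).
    exact: countableP.
pose le (p q : {p | ok p}) := `[< (sval p).1 `<=` (sval q).1 /\
   forall x, ((sval p).1 `*` (sval p).1) x -> (sval p).2 x = (sval q).2 x >].
have [| | |[[B f] Bok] Bmax] := @ZL_preorder _ (exist _ p0 p0ok) le.
- by move=> p; apply/asboolP; split.
- move=> p q r /asboolP[pq pqE] /asboolP[qr qrE]; apply/asboolP; split.
    exact: subset_trans qr.
  move=> x px; rewrite pqE // qrE //.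
  by have [? ?] := px; split; exact: pq.
- move=> F Ftot.
  have [->|/set0P[p1 Fp1]] := eqVneq F set0; first by exists (exist _ p0 p0ok).
  pose B := \bigcup_(p in F) (sval p).1.
  have Bpair (x : T * T) : (B `*` B) x ->
      exists2 p, F p & ((sval p).1 `*` (sval p).1) x.
    move=> [[p Fp px] [q Fq qx]].
    have [/asboolP[pq _]|/asboolP[qp _]] := Ftot p q Fp Fq.
      by exists q => //; split=> //; exact: pq.
    by exists p => //; split=> //; exact: qp.
  have /choice[k kP] : forall x, exists p, (B `*` B) x ->
      F p /\ ((sval p).1 `*` (sval p).1) x.
    move=> x; have [/Bpair[p Fp px]|nx] := pselect ((B `*` B) x); first by exists p.
    by exists p1.
  (* The union of the chain of injections: by [fE] its value does not depend on the chosen member of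
     the chain. *)
  pose f x := (sval (k x)).2 x.
  have fE p x : F p -> ((sval p).1 `*` (sval p).1) x -> f x = (sval p).2 x.
    move=> Fp px; have [|Fk kx] := kP x.
      by have [? ?] := px; split; exists p.
    rewrite /f.
    by have [/asboolP[_ ->]|/asboolP[_ ->]] := Ftot _ _ Fk Fp.
  have Bok : ok (B, f).
    split=> /=.
    + by move=> x [p Fp px]; have [pA _ _ _] := svalP p; exact: pA.
    + apply: (@sub_infinite_set _ (sval p1).1); last by have [] := svalP p1.
      by move=> x px; exists p1.
    + move=> x /Bpair[p Fp px]; rewrite (fE _ _ Fp px); exists p => //.
      by have [_ _ pf _] := svalP p; exact: pf.
    + move=> x y /set_mem Bx /set_mem By.
      have [p Fp [px py]] : exists2 p, F p & ((sval p).1 `*` (sval p).1) x /\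
          ((sval p).1 `*` (sval p).1) y.
        have [[p Fp px] [q Fq qy]] := (Bpair _ Bx, Bpair _ By).
        have [/asboolP[pq _]|/asboolP[qp _]] := Ftot p q Fp Fq.
          by exists q => //; split=> //; case: px => ? ?; split; exact: pq.
        by exists p => //; split=> //; case: qy => ? ?; split; exact: qp.
      rewrite (fE _ _ Fp px) (fE _ _ Fp py).
      by have [_ _ _ pinj] := svalP p; apply: pinj; exact/mem_set.
  exists (exist _ (B, f) Bok) => p Fp; apply/asboolP; split.
    by move=> x px; exists p.
  by move=> x px /=; rewrite (fE _ _ Fp px).
have Bsq := sq _ Bok; have [BA Binf fB finj] := Bok; rewrite /= in BA Binf fB finj Bsq.
suff AB : A #<= B.
  apply: card_le_trans (card_le_setX AB AB) _; apply: card_le_trans Bsq _.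
  exact: subset_card_le.
apply: contrapT => nAB.
have : B #<= A `\` B.
  apply: not_card_le => ADB; apply: nAB.
  apply: card_le_trans (card_setU_le_of_square Binf Bsq (card_lexx B) ADB).
  by apply: subset_card_le => x Ax; have [?|?] := pselect (B x); [left|right].
move=> /card_subP[C CB CAB].
have [BC CBle] := ((card_eqPle _ _).1 (card_esym CB)).
(* [h] will be used only off the square of [B]; its values lie in [C], disjoint from [B], so gluing
   it to [f] keeps injectivity. *)
have [h hC hinj] : exists2 h : T * T -> T,
    set_fun ((B `|` C) `*` (B `|` C)) C h & set_inj ((B `|` C) `*` (B `|` C)) h.
  apply: card_le_inj_fun.
    by apply/infinite_setN0/infiniteP/(card_le_trans _ BC)/infiniteP.
  have BCB := card_setU_le_of_square Binf Bsq (card_lexx B) CBle.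
  exact: card_le_trans (card_le_setX BCB BCB) (card_le_trans Bsq BC).
pose f' x := if pselect ((B `*` B) x) then f x else h x.
have f'B x : (B `*` B) x -> f' x = f x by rewrite /f'; case: pselect.
have f'C x : ~ (B `*` B) x -> f' x = h x by rewrite /f'; case: pselect.
have BCok : ok (B `|` C, f').
  split=> /=.
  - by move=> x [/BA//|/CAB[]].
  - by apply: sub_infinite_set Binf; exact: subsetUl.
  - move=> x BCx; have [Bx|nBx] := pselect ((B `*` B) x).
      by rewrite f'B //; left; exact: fB.
    by rewrite f'C //; right; exact: hC.
  - move=> x y xBC yBC; move: (xBC) (yBC) => /set_mem BCx /set_mem BCy.
    have [Bx|nBx] := pselect ((B `*` B) x); have [By|nBy] := pselect ((B `*` B) y).
    + by rewrite !f'B //; apply: finj; exact/mem_set.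
    + rewrite f'B // f'C // => fh.
      by have /CAB[_] := hC _ BCy; rewrite -fh => /(_ (fB _ Bx)).
    + rewrite f'C // f'B // => hf.
      by have /CAB[_] := hC _ BCx; rewrite hf => /(_ (fB _ By)).
    + by rewrite !f'C //; exact: hinj.
have lef' : le (exist _ (B, f) Bok) (exist _ (B `|` C, f') BCok).
  by apply/asboolP; split=> [x ?|x Bx] /=; [left|rewrite f'B].
have /asboolP[+ _] := Bmax _ lef'.
have [c Cc] : C !=set0.
  by apply/infinite_setN0/infiniteP/(card_le_trans _ BC)/infiniteP.
by move=> /= /(_ c (or_intror Cc)) Bc; have [] := CAB _ Cc.
Qed.

Lemma card_bigcup_le {T U I : Type} {C : set T} {J : set I} {F : I -> set U} :
  infinite_set C -> J #<= C -> (forall i, J i -> F i #<= C) ->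
  \bigcup_(i in J) F i #<= C.
Proof. by move=> /card_setX_infinite; exact: card_bigcup_le_of_square. Qed.

Lemma card_setU1_lt {T U : Type} {A : set T} {B : set U} (b : U) :
  infinite_set A -> card_lt B A -> card_lt (B `|` [set b]) A.
Proof.
move=> Ainf [_ nAB]; apply/card_ltP => AB1; apply: nAB.
have Binf : infinite_set B.
  move=> Bfin; apply/Ainf/(card_le_finite AB1).
  by rewrite finite_setU; split=> //; exact: finite_set1.
apply: card_le_trans AB1 _.
apply: card_setU_le_of_square => //; first exact: card_setX_infinite.
by apply: card_le_trans ((infiniteP B).1 Binf); apply/finite_set_countable/finite_set1.
Qed.

(** * Well-orders with small initial segments *)

(** If some segment of [A] is as large as [A], the part of [A] below the first point [a] with such a
    segment serves as [W], and minimality of [a] makes its segments small; otherwise [W] is [A]. *)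
Lemma infinite_well_order {T : Type} {A : set T} : infinite_set A ->
  exists (W : set T) (R : T -> T -> Prop),
  [/\ W #= A,
      forall v w, R v w \/ R w v,
      forall u v w, R u v -> R v w -> R u w &
      forall w, W w -> card_lt [set v | W v /\ R v w] A].
Proof.
move=> Ainf; have [R Rwo] := @well_ordering_principle {classic T}.
(* Totality, antisymmetry and transitivity come from unique minima of sets of two or three
   points. *)
have Rtot (v w : T) : R v w \/ R w v.
  have [|z [[zvw zmin] _]] := Rwo [pred x : {classic T} | (x == v) || (x == w)].
    by exists v; rewrite inE eqxx.
  have /orP[/eqP zE|/eqP zE] := zvw; [left|right]; rewrite -zE; apply: zmin;
    by rewrite inE eqxx ?orbT.
have Rxx (v : T) : R v v by case: (Rtot v v).
have Rmin (P : set T) : P !=set0 -> exists2 z, P z & forall x, P x -> R z x.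
  move=> [p Pp]; have [|z [[zP zmin] _]] := Rwo [pred x : {classic T} | `[< P x >]].
    by exists p; apply/asboolP.
  exists z; first exact/asboolP.
  by move=> x Px; apply: zmin; apply/asboolP.
have Ranti (v w : T) : R v w -> R w v -> v = w.
  move=> vw wv; have [|z [_ zuniq]] := Rwo [pred x : {classic T} | (x == v) || (x == w)].
    by exists v; rewrite inE eqxx.
  have mn (y : T) : R y v -> R y w -> (y == v :> {classic T}) || (y == w :> {classic T}) ->
      minimum_of R [pred x : {classic T} | (x == v) || (x == w)] y.
    by move=> ? ? ?; split=> // x /orP[] /eqP ->.
  by rewrite -(zuniq v) ?(zuniq w) //; apply: mn => //; rewrite eqxx ?orbT.
have Rtrans (u v w : T) : R u v -> R v w -> R u w.
  move=> uv vw; have [|z zP zmin] := Rmin [set u; v; w]; first by exists u; left; left.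
  have [[zE|zE]|zE] := zP; first by rewrite -zE; apply: zmin; right.
    by have -> : u = v by apply: Ranti => //; rewrite -zE; apply: zmin; left; left.
  have vE : v = w by apply: Ranti => //; rewrite -zE; apply: zmin; left; right.
  by rewrite -vE.
pose below (w : T) := [set v : T | A v /\ R v w /\ v <> w].
(* The segments of the statement contain [w] itself; one extra point does not bring a smaller set up
   to the size of the infinite [A]. *)
have ltA (W : set T) w : W `<=` A -> ~ (A #<= below w) ->
    card_lt [set v : T | W v /\ R v w] A.
  move=> WA /card_ltP /(card_setU1_lt w Ainf); apply: card_le_lt_trans.
  apply: subset_card_le => v [Wv vw].
  have [->|nvw] := pselect (v = w); first by right.
  by left; split; [exact: WA|].
have [long0|/set0P/Rmin[a [Aa Ale] amin]] :=
    eqVneq [set a | A a /\ A #<= below a] set0.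
  exists A, R; split=> // w Aw; apply: ltA => // le.
  by have : [set a | A a /\ A #<= below a] w by []; rewrite long0.
have belowA : below a `<=` A by move=> v [].
exists (below a), R; split => //.
  by apply/card_eqPle; split => //; exact: subset_card_le.
move=> w [Aw [wa nwa]]; apply: ltA => // le.
by apply: nwa; apply: Ranti => //; exact: amin.
Qed.

(** * Finite unions and power sets *)

(** Stage [n] consists of the unions of [n] members of [N], repetitions allowed, so that closure
    under union and the size bound both go by induction on [n]. *)
Definition finite_unions {T : Type} (N : set (set T)) : set (set T) :=
  \bigcup_n iter n (fun F => \bigcup_(A in N) [set A `|` B | B in F]) [set set0].

Lemma sub_finite_unions {T : Type} (N : set (set T)) : N `<=` finite_unions N.
Proof. by move=> A NA; exists 1 => //; exists A => //; exists set0 => //; rewrite setU0. Qed.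

Lemma finite_unionsU {T : Type} {N : set (set T)} {A B : set T} :
  finite_unions N A -> finite_unions N B -> finite_unions N (A `|` B).
Proof.
move=> [n _ +] NB; elim: n A => [A ->|n IHn A [C NC [D nD <-]]]; first by rewrite set0U.
by have [m _ mDB] := IHn _ nD; exists m.+1 => //; exists C => //; exists (D `|` B); rewrite ?setUA.
Qed.

Lemma card_finite_unions {T : Type} {N : set (set T)} :
  infinite_set N -> finite_unions N #<= N.
Proof.
move=> Ninf; apply: card_bigcup_le => //; first exact/infiniteP.
move=> n _; elim: n => [|n IHn] /=.
  apply: card_le_trans ((infiniteP N).1 Ninf).
  exact/finite_set_countable/finite_set1.
apply: card_bigcup_le => // A NA.
exact: card_le_trans (card_image_le _ _) IHn.
Qed.

Lemma card_le_powerset {T U : Type} {A : set T} {B : set U} :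
  A #<= B -> [set C | C `<=` A] #<= [set D | D `<=` B].
Proof.
move=> AB; have [B0|/set0P B0] := eqVneq B set0.
  move: AB; rewrite B0 => /card_le0P ->.
  apply: (@inj_fun_card_le _ _ _ _ (fun=> set0)) => [C _|C D]; first exact: sub0set.
  by move=> /set_mem/= + /set_mem/=; rewrite !subset0 => -> ->.
have [f fA finj] := card_le_inj_fun B0 AB.
apply: (@inj_fun_card_le _ _ _ _ (fun C => f @` C)).
  by move=> C CA _ [x /CA Ax <-]; exact: fA.
have sub C D : C `<=` A -> D `<=` A -> f @` C = f @` D -> C `<=` D.
  move=> CA DA fCD x Cx.
  have [y Dy fyx] : (f @` D) (f x) by rewrite -fCD; exists x.
  by rewrite -(finj y x) //; apply/mem_set; [exact: DA|exact: CA].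
move=> C D /set_mem CA /set_mem DA fCD.
by apply/seteqP; split; apply: sub.
Qed.

Lemma finite_powerset {T : Type} {A : set T} :
  finite_set A -> finite_set [set B | B `<=` A].
Proof.
move=> [n /card_eqPle[+ _]]; rewrite (card_le_eqr card_II) => /card_le_powerset.
move=> /card_le_finite; apply.
have -> : [set D | D `<=` [set: 'I_n]] = range (fun D : {set 'I_n} => [set` D]).
  apply/seteqP; split=> // D _; exists [set i | `[< D i >]]%SET => //.
  by apply/seteqP; split=> i /=; rewrite inE => /asboolP.
exact/finite_image/finite_finset.
Qed.

(** * Infinite sets of naturals and subsequences *)

Lemma finite_nat_bounded {S : set nat} :
  finite_set S -> exists m, forall n, S n -> (n < m)%N.
Proof.
move=> /finite_seqP[s ->]; exists (\max_(i <- s) i).+1 => n /= ns.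
by rewrite ltnS; apply: leq_bigmax_seq.
Qed.

Lemma bounded_nat_finite {S : set nat} (m : nat) :
  (forall n, S n -> (n < m)%N) -> finite_set S.
Proof. by move=> Sm; apply: sub_finite_set (finite_II m). Qed.

Lemma infinite_nat_unbounded {S : set nat} :
  infinite_set S -> forall m, exists2 n, (m <= n)%N & S n.
Proof.
move=> Sinf m; apply: contrapT => nS; apply: Sinf; apply: (@bounded_nat_finite _ m) => n Sn.
by rewrite ltnNge; apply/negP => mn; apply: nS; exists n.
Qed.

(** The bound [k <= phi k] makes [phi] tend to infinity, which serves in place of a strictly
    increasing enumeration of [S]. *)
Lemma infinite_nat_subsequence {S : set nat} : infinite_set S ->
  exists phi : nat -> nat, forall k, (k <= phi k)%N /\ S (phi k).
Proof.
move=> Sinf; have /choice[phi phiP] : forall m, exists n, (m <= n)%N /\ S n.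
  by move=> m; have [n mn Sn] := infinite_nat_unbounded Sinf m; exists n.
by exists phi.
Qed.

Lemma cvg_subsequence {X : topologicalType} {u : nat -> X} {x : X} {phi : nat -> nat} :
  (forall k, (k <= phi k)%N) -> u @ \oo --> x -> (u \o phi) @ \oo --> x.
Proof.
move=> phik ux; apply: cvg_comp ux => A [m _ mA]; exists m => // k /= mk.
by apply: mA => /=; exact: leq_trans mk (phik k).
Qed.

(** * Building cs-networks from cs*-networks *)

Lemma cs_network_star {X : topologicalType} {x : X} {N : set (set X)} :
  cs_network x N -> cs_star_network x N.
Proof.
move=> Nx U u Ux ux; have [A [NA AU Afin]] := Nx U u Ux ux.
exists A; split => // Ainf; apply: infinite_nat.
rewrite -(setUv [set n | A (u n)]) finite_setU; split => //.
Qed.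

Lemma cs_star_network_neq0 {X : topologicalType} {x : X} {N : set (set X)} :
  cs_star_network x N -> N !=set0.
Proof.
move=> Nx; have [|A [NA _ _]] := Nx setT (fun=> x) filterT; first exact: cvg_cst.
by exists A.
Qed.

(** Choose in each member not inside [{x}] a point other than [x]. These finitely many points form a
    closed set by T1, so a member of [N] avoiding them lies in [{x}] and catches no term of a
    subsequence that differs from [x] throughout. *)
Lemma cs_network_set1 {X : topologicalType} {x : X} {N : set (set X)} :
  accessible_space X -> cs_star_network x N -> finite_set N ->
  cs_network x [set [set x]].
Proof.
move=> T1_X Nx Nfin U u Ux ux.
exists [set x]; split => //; first by move=> _ ->; exact: nbhs_singleton.
apply: contrapT => /infinite_nat_subsequence[phi phiP].
have /choice[y yP] : forall A : set X, exists y, ~ (A `<=` [set x]) -> A y /\ y <> x.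
  move=> A; have [[y Ay yx]|nA] := pselect (exists2 y, A y & y <> x); first by exists y.
  exists x => -[]; move=> z Az; apply: contrapT => zx; apply: nA.
  by exists z.
pose F := y @` (N `&` [set A | ~ (A `<=` [set x])]).
have Fclosed : closed F.
  by apply: (accessible_finite_set_closed.1 T1_X); apply/finite_image/finite_setIl.
have nFx : nbhs x (~` F).
  apply: open_nbhs_nbhs; split; first by rewrite openC.
  by move=> [A [_ /yP[_ yx]]].
have [A [NA AF Ainf]] := Nx _ _ nFx (cvg_subsequence (fun k => (phiP k).1) ux).
have Ax : A `<=` [set x].
  by apply: contrapT => nA; have [/AF + _] := yP A nA; apply; exists A.
by have [k /Ax /(phiP k).2] := infinite_setN0 Ainf.
Qed.

(** The last hypothesis is the form in which [N] being smaller than p is used. It applies because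
    the index sets missed by two unions intersect in the set missed by their union, and each is
    infinite when no finite union inside [U] holds a tail. *)
Lemma cs_network_finite_unions {X : topologicalType} {x : X} {N : set (set X)} :
  infinite_set N -> cs_star_network x N ->
  (forall F : set (set nat), F #<= N -> (forall S, F S -> infinite_set S) ->
    setI_closed F -> exists2 I, infinite_set I & pseudo_intersection F I) ->
  cs_network x (finite_unions N).
Proof.
move=> Ninf Nx pN U u Ux ux; apply: contrapT => nU.
pose G := [set A | finite_unions N A /\ A `<=` U].
have [| | |I Iinf IP] := pN [set [set n | ~ A (u n)] | A in G].
- apply: card_le_trans (card_image_le _ _) _.
  by apply: card_le_trans _ (card_finite_unions Ninf); apply: subset_card_le => A [].
- by move=> _ [A [NA AU] <-] Afin; apply: nU; exists A.
- move=> _ _ [A [NA AU] <-] [B [NB BU] <-]; exists (A `|` B).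
    by split; [exact: finite_unionsU|rewrite subUset].
  apply/seteqP; split=> n; first by move=> nAB; split=> ?; apply: nAB; [left|right].
  by move=> [nA nB] [].
(* Along [phi], with values in [I], every member of [N] inside [U] catches only finitely many terms,
   contrary to the cs*-property. *)
have [phi phiP] := infinite_nat_subsequence Iinf.
have [A [NA AU Ainf]] := Nx _ _ Ux (cvg_subsequence (fun k => (phiP k).1) ux).
have [|m IAm] := finite_nat_bounded (IP [set n | ~ A (u n)] _).
  by exists A => //; split=> //; exact: sub_finite_unions.
apply: Ainf; apply: (bounded_nat_finite m) => k Ak.
apply: leq_ltn_trans (phiP k).1 (IAm _ _).
by split; [exact: (phiP k).2|apply].
Qed.

(** Ranges of sequences, that is, the nonempty countable subsets; this form bounds their number by
    that of the functions from [nat] to [A]. *)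
Definition countable_subsets {T : Type} (A : set T) : set (set T) :=
  [set range f | f in [set f : nat -> T | forall n, A (f n)]].

(* Well-order [N] so that proper initial segments are smaller than [N], and take
   the countable unions from each of these segments. If [u] converges to [x] in
   [U] but escapes infinitely often, for every initial segment, the union of its
   members inside [U], then countably many members of [N] inside [U] cover a tail
   of [u], they must be cofinal in the well-order, and a diagonal subsequence of
   [u] almost avoids every member of [N] inside [U]. *)
Lemma cs_network_countable_unions {X : topologicalType} {x : X}
    {N : set (set X)} {T : Type} {L : set T} :
  infinite_set N -> cs_star_network x N -> N #<= L ->
  (forall A : set (set X), card_lt A L -> countable_subsets A #<= L) ->
  exists2 N', cs_network x N' & N' #<= L.
Proof.
move=> Ninf Nx NL ltL; have [W [R [WN Rtot Rtrans Rseg]]] := infinite_well_order Ninf.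
have /card_set_bijP[e [eN _ eW]] := WN.
pose seg w := e @` [set v | W v /\ R v w].
have segL w : W w -> card_lt (seg w) L.
  move=> Ww; apply: card_le_lt_trans (card_image_le _ _) _.
  exact: card_lt_le_trans (Rseg _ Ww) NL.
exists (\bigcup_(w in W) [set \bigcup_(A in C) A | C in countable_subsets (seg w)]).
  move=> U u Ux ux.
  pose covered w n := exists A, [/\ seg w A, A `<=` U & A (u n)].
  suff [w Ww [m wm]] : exists2 w, W w & exists m, forall n, (m <= n)%N -> covered w n.
    have /choice[f fP] : forall n, exists A, [/\ seg w A, A `<=` U & A (u (m + n)%N)].
      by move=> n; apply: wm; rewrite leq_addr.
    exists (\bigcup_(A in range f) A); split.
    - exists w => //; exists (range f) => //; exists f => // n.
      by have [] := fP n.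
    - by move=> y [_ [n _ <-]]; have [_ + _] := fP n; apply.
    - apply: (bounded_nat_finite m) => n /= un; rewrite ltnNge; apply/negP => mn.
      apply: un; exists (f (n - m)%N); first by exists (n - m)%N.
      by have [_ _] := fP (n - m)%N; rewrite subnKC.
  apply: contrapT => ncov.
  have escape w k : W w -> exists n, (k <= n)%N /\ ~ covered w n.
    move=> Ww; apply: contrapT => nesc; apply: ncov; exists w => //; exists k => n kn.
    by apply: contrapT => nc; apply: nesc; exists n.
  (* Otherwise infinitely many terms lie in no member inside [U], and a subsequence of them
     contradicts the cs*-property. *)
  have [m Um] : exists m, forall n, (m <= n)%N -> exists A, [/\ N A, A `<=` U & A (u n)].
    apply: contrapT => nm.
    have [|phi phiP] := @infinite_nat_subsequence
        [set n | ~ exists A, [/\ N A, A `<=` U & A (u n)]].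
      move=> /finite_nat_bounded[m mP]; apply: nm; exists m => n mn.
      by apply: contrapT => /mP; rewrite ltnNge mn.
    have [A [NA AU Ainf]] := Nx _ _ Ux (cvg_subsequence (fun k => (phiP k).1) ux).
    by have [k Ak] := infinite_setN0 Ainf; apply: (phiP k).2; exists A.
  have /choice[c cP] : forall n, exists v, [/\ W v, e v `<=` U & e v (u (m + n)%N)].
    move=> n; have [A [/eW[v Wv <-] AU Au]] := Um _ (leq_addr n m).
    by exists v.
  (* [mx k] is a largest one among [c 0], ..., [c k], so that [phi k] below escapes the segments up
     to all of them. *)
  have /choice[mx mxP] : forall k, exists w, W w /\ forall i, (i <= k)%N -> R (c i) w.
    elim=> [|k [w [Ww wk]]].
      exists (c 0); split; first by have [] := cP 0.
      by move=> i; rewrite leqn0 => /eqP ->; case: (Rtot (c 0) (c 0)).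
    have [wc|cw] := Rtot w (c k.+1).
      exists (c k.+1); split; first by have [] := cP k.+1.
      move=> i; rewrite leq_eqVlt => /orP[/eqP ->|/wk iw]; last exact: Rtrans iw wc.
      by case: (Rtot (c k.+1) (c k.+1)).
    by exists w; split=> // i; rewrite leq_eqVlt => /orP[/eqP ->|/wk].
  have /choice[phi phiP] : forall k, exists n, (k <= n)%N /\ ~ covered (mx k) n.
    by move=> k; apply: escape; case: (mxP k).
  have [A [/eW[v Wv vA] AU Ainf]] := Nx _ _ Ux (cvg_subsequence (fun k => (phiP k).1) ux).
  (* If no [c n] were above [v], all would lie in the segment of [v], which would then cover every
     term from [m] on. *)
  have [n vc] : exists n, R v (c n).
    apply: contrapT => nv; have [k [mk]] := escape v m Wv; apply.
    have [Wc cU cu] := cP (k - m)%N; exists (e (c (k - m)%N)); split=> //.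
      exists (c (k - m)%N) => //; split=> //.
      by have [//|vc] := Rtot (c (k - m)%N) v; case: nv; exists (k - m)%N.
    by rewrite subnKC in cu.
  (* For such [k], [v] is below [c n], hence below [mx k], so [A] would cover the term that [phi k]
     was chosen to leave uncovered. *)
  have [k nk Ak] := infinite_nat_unbounded Ainf n.
  apply: (phiP k).2; exists A; split => //; exists v => //; split=> //.
  by apply: Rtrans vc _; have [_] := mxP k; apply.
have Linf : infinite_set L by apply/infiniteP/(card_le_trans _ NL)/infiniteP.
apply: card_bigcup_le => //; first by rewrite (card_le_eql WN).
by move=> w Ww; apply: card_le_trans (card_image_le _ _) (ltL _ (segL _ Ww)).
Qed.

(** * From networks at points to the characters *)

Lemma least_card_le {T : Type} {P : set (set T)} {A : set T} :
  P A -> least_card P #<= A.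
Proof. by move=> PA; have [|_] := @least_cardP _ P; [exists A|exact]. Qed.

Lemma network_character_le {X : topologicalType} {network : X -> set (set (set X))}
    {L : set (set X)} :
  [set: X] !=set0 -> (forall x, exists2 N, network x N & N #<= L) ->
  network_character network #<= L.
Proof.
move=> X0 netL; rewrite /network_character; case: pselect => [? /=|//].
have PL : [set K : set (set X) | forall x, least_card (network x) #<= K] L.
  move=> x; have [N xN NL] := netL x.
  exact: card_le_trans (least_card_le xN) NL.
exact: least_card_le.
Qed.

Lemma network_character_ge {X : topologicalType} {network : X -> set (set (set X))} :
  (forall x, network x !=set0) ->
  forall x, exists2 N, network x N & N #<= network_character network.
Proof.
move=> net0 x; have [xmin _] := least_cardP (net0 x).
exists (least_card (network x)) => //; rewrite /network_character.
case: pselect => [X0 /=|]; last by case; exists x.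
have [|+ _] := @least_cardP _ [set K : set (set X) | forall x, least_card (network x) #<= K].
  by exists setT => y; exact: card_leT.
exact.
Qed.

(** Makes the families of networks nonempty, so that their least cardinals are attained. *)
Lemma cs_network_setT {X : topologicalType} (x : X) : cs_network x setT.
Proof.
move=> U u Ux ux; exists U; split=> //.
have [m _ mU] := ux _ Ux; apply: (bounded_nat_finite m) => n nU.
by rewrite ltnNge; apply/negP => mn; exact/nU/mU.
Qed.

Lemma cs_star_character_network {X : topologicalType} (x : X) :
  exists2 N, cs_star_network x N & N #<= cs_star_character X.
Proof.
apply: network_character_ge => y; exists setT.
exact/cs_network_star/cs_network_setT.
Qed.

Lemma cs_star_character_le (X : topologicalType) :
  [set: X] !=set0 -> cs_star_character X #<= cs_character X.
Proof.
move=> X0; apply: network_character_le => // x.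
have [|N xN NL] := @network_character_ge X (cs_network (X:=X)) _ x.
  by move=> y; exists setT; exact: cs_network_setT.
by exists N => //; exact: cs_network_star.
Qed.

(** Finite cs*-networks are settled by [cs_network_set1], since a one-member network is no larger
    than any nonempty [N]. *)
Lemma cs_character_le_of_infinite {X : topologicalType} :
  accessible_space X -> [set: X] !=set0 ->
  (forall (x : X) N, cs_star_network x N -> infinite_set N -> N #<= cs_star_character X ->
     exists2 N', cs_network x N' & N' #<= cs_star_character X) ->
  cs_character X #<= cs_star_character X.
Proof.
move=> T1_X X0 infX; apply: network_character_le => // x.
have [N xN NL] := cs_star_character_network x.
have [Nfin|Ninf] := pselect (finite_set N); last exact: infX xN Ninf NL.
exists [set [set x]]; first exact: cs_network_set1 T1_X xN Nfin.
have [A NA] := cs_star_network_neq0 xN.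
apply: card_le_trans NL; rewrite (card_le_eql (eq_card1 [set x] A)).
by apply: subset_card_le => _ ->.
Qed.

Lemma cs_character_le_of_lt_p {X : topologicalType} :
  accessible_space X -> [set: X] !=set0 ->
  card_lt (cs_star_character X) pseudo_intersection_number ->
  cs_character X #<= cs_star_character X.
Proof.
move=> T1_X X0 [_ ltp]; apply: cs_character_le_of_infinite => // x N xN Ninf NL.
exists (finite_unions N); last exact: card_le_trans (card_finite_unions Ninf) NL.
apply: cs_network_finite_unions => // F FN Finf FI; apply: contrapT => nI.
apply: ltp; apply: card_le_trans (card_le_trans FN NL).
exact: least_card_le.
Qed.

(** The bound is asked only for an infinite character, as an infinite [N] below it guarantees; the
    GCH argument relies on this. *)
Lemma cs_character_le_of_countable_subsets {X : topologicalType} :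
  accessible_space X -> [set: X] !=set0 ->
  (infinite_set (cs_star_character X) ->
   forall A : set (set X), card_lt A (cs_star_character X) ->
     countable_subsets A #<= cs_star_character X) ->
  cs_character X #<= cs_star_character X.
Proof.
move=> T1_X X0 ltL; apply: cs_character_le_of_infinite => // x N xN Ninf NL.
apply: (cs_network_countable_unions Ninf xN NL); apply: ltL.
by apply/infiniteP/(card_le_trans _ NL)/infiniteP.
Qed.

(** * Cardinal bounds for the five conditions *)

Lemma card_countable_subsets_le_functions {T : Type} (A : set T) :
  countable_subsets A #<= [set: nat -> A].
Proof.
apply: card_le_trans (_ : range (fun f : nat -> A => range (fun n => val (f n))) #<= _);
  last exact: card_image_le.
apply: subset_card_le => _ [f fA <-]; exists (fun n => SigSub (mem_set (fA n))) => //.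
Qed.

Lemma countable_subsets_powerset {T : Type} (A : set T) :
  countable_subsets A `<=` [set B | B `<=` A].
Proof. by move=> _ [f fA <-] _ [n _ <-]; exact: fA. Qed.

(** A failure for infinite [A] would place [L] strictly between [A] and its power set. For finite
    [A] the power set is finite, hence below the infinite [L]. *)
Lemma GCH_powerset_le {T U : Type} {A : set T} {L : set U} :
  GCH -> infinite_set L -> card_lt A L -> [set B | B `<=` A] #<= L.
Proof.
move=> gch Linf AL; have [Afin|Ainf] := pselect (finite_set A).
  apply: card_le_trans ((infiniteP L).1 Linf).
  exact/finite_set_countable/finite_powerset.
(* [GCH] speaks of types, so [A] and [L] are replaced by their subtypes. *)
have AA := (card_eqPle _ _).1 (card_setT A).
apply: contrapT => nAL; apply: (gch A).
  by apply/infiniteP; rewrite (card_le_eqr (card_setT A)); exact/infiniteP.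
exists L; split.
  apply: card_le_lt_trans AA.1 _; apply: card_lt_le_trans AL _.
  by rewrite (card_le_eqr (card_setT L)).
apply/card_ltP => AL'; apply: nAL.
apply: card_le_trans (card_le_powerset AA.2) _.
apply: card_le_trans (_ : [set: set A] #<= _); first exact: card_leT.
by rewrite (card_le_eqr (card_setT L)) in AL'.
Qed.

Lemma card_countable_sets_le_continuum {T : Type} (A : set (set T)) :
  countable [set: T] -> A #<= continuum.
Proof.
move=> /card_le_powerset T2; apply: card_le_trans (card_leT A) _.
apply: card_le_trans (_ : [set B : set T | B `<=` [set: T]] #<= _).
  exact: subset_card_le.
apply: card_le_trans T2 _.
apply: (@inj_fun_card_le _ _ _ _ (fun (D : set nat) n => `[< D n >])) => // C D _ _ CD.
have CDn n : `[< C n >] = `[< D n >] by exact: (congr1 (fun f => f n) CD).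
by apply/seteqP; split=> n /asboolP; [rewrite CDn|rewrite -CDn] => /asboolP.
Qed.

Theorem proposition2 (X : topologicalType) (T1_X : accessible_space X) :
  (* (1) *)
  card_lt (cs_star_character X) pseudo_intersection_number \/
  (* (2) *)
  (forall K : Type, card_lt [set: K] (cs_star_character X) ->
     [set: nat -> K] #<= cs_star_character X) \/
  (* (3) *)
  (pseudo_intersection_number #= continuum /\
   forall L K : Type, card_lt [set: L] [set: K] -> continuum #<= [set: K] ->
     [set: nat -> L] #<= [set: K]) \/
  (* (4) *)
  (pseudo_intersection_number #= continuum /\ countable [set: X]) \/
  (* (5) *)
  GCH ->
  cs_star_character X #= cs_character X.
Proof.
(* For empty [X] both characters unfold to the same singleton. *)
move=> hyp; have [X0|X0] := pselect ([set: X] !=set0); last first.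
  by rewrite /cs_star_character /cs_character /network_character; case: pselect => [//|? /=].
apply/card_eqPle; split; first exact: cs_star_character_le.
have lt_p_or : pseudo_intersection_number #= continuum ->
    card_lt (cs_star_character X) pseudo_intersection_number \/
    continuum #<= cs_star_character X.
  move=> pc; have [|nle] := pselect (continuum #<= cs_star_character X); first by right.
  by left; apply/card_ltP; rewrite (card_le_eql pc).
case: hyp => [lt_p|[pow|[[pc pow]|[[pc countX]|gch]]]].
- exact: cs_character_le_of_lt_p.
- apply: cs_character_le_of_countable_subsets => // _ A AL.
  apply: card_le_trans (card_countable_subsets_le_functions A) (pow _ _).
  by apply: card_le_lt_trans AL; rewrite (card_le_eql (card_setT A)).
- have [lt_p|cL] := lt_p_or pc; first exact: cs_character_le_of_lt_p.
  apply: cs_character_le_of_countable_subsets => // _ A AL.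
  (* Condition (3) quantifies over types, so the character is passed to it as a subtype. *)
  have LL := (card_eqPle _ _).1 (card_setT (cs_star_character X)).
  apply: card_le_trans (card_countable_subsets_le_functions A) _.
  apply: card_le_trans LL.1; apply: pow; last exact: card_le_trans LL.2.
  apply: card_lt_le_trans LL.2; apply: card_le_lt_trans AL.
  by rewrite (card_le_eql (card_setT A)).
- have [lt_p|cL] := lt_p_or pc; first exact: cs_character_le_of_lt_p.
  (* A character is a set of subsets of the countable [X], hence of size at most c. *)
  exact: card_le_trans (card_countable_sets_le_continuum _ countX) cL.
- apply: cs_character_le_of_countable_subsets => // Linf A AL.
  apply: card_le_trans (GCH_powerset_le gch Linf AL).
  exact: subset_card_le (@countable_subsets_powerset _ A).
Qed.
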